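(* Let $K$ be a commutative ring with identity, $R=K[x_1,\ldots,x_n]$, $R_0=K$ and $R_i=K[x_{n-i+1},\ldots,x_n]$ for $1\le i\le n$. Let $M=\bigoplus_{s\in\mathbb{N}}M_s$ be a finitely generated graded $R$-module. Assume that $M$ is generated over $(R_i)_{i=0}^n$ by a finite set of homogeneous elements $g_{ij}$ of degrees $d_{ij}\in\mathbb{N}$, and let $d(M)=\max\{d_{ij}\}$. Let $s_{ij}\in M$ be any set of homogeneous elements of degrees $d_{ij}$ which generates $M_s$ over $(R_i)_{i=0}^n$ for all $s\leq d(M)+1$. Then the elements $s_{ij}$ generate $M$ over $(R_i)_{i=0}^n$. Moreover, if $(g_{ij})$ is a basis of $M$ over $(R_i)_{i=0}^n$ and it majorizes $(s_{ij})$ up to degree $d(M)+1$, then $(s_{ij})$ is a basis of $M$ over $(R_i)_{i=0}^n$.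
   Context: $R$ is graded by total degree with $K$ in degree $0$. A finite family of homogeneous elements $g_{ij}\in M$ (where the first index $i\in\{0,\ldots,n\}$ indicates that $g_{ij}$ is multiplied by elements of $R_i$) generates $M$ over $(R_i)_{i=0}^n$ if $M=\sum_{i,j}R_i\cdot g_{ij}$; it generates $M_s$ over $(R_i)$ if $M_s=\sum_{i,j}(R_i)_{s-\deg g_{ij}}\cdot g_{ij}$. It is a basis of $M$ over $(R_i)_{i=0}^n$ if $M=\bigoplus_{i,j}R_i\cdot g_{ij}$ with each $R_ig_{ij}$ free of rank one over $R_i$ (i.e. it generates, and $\sum c_{ij}g_{ij}=0$ with $c_{ij}\in R_i$ implies all $c_{ij}=0$). A basis $(a_{ij})$ of $M$ majorizes up to degree $d$ a set of homogeneous elements $(b_{ij})$ if there is a bijective correspondence $a_{ij}\leftrightarrow b_{ij}$ preserving degrees and the multiplication rings $R_i$, and the $b_{ij}$ generate $M_s$ over $(R_i)_{i=0}^n$ for all $s\le d$. *)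

(* Defs.v *)
From HB Require Import structures.
From mathcomp Require Import all_boot all_order all_algebra.
From mathcomp Require Export mpoly.

Set Implicit Arguments.
Unset Strict Implicit.
Unset Printing Implicit Defensive.

Import GRing.Theory.
Local Open Scope ring_scope.

(* The subring R_i = K[x_{n-i+1}, ..., x_n] of K[x_1, ..., x_n].  The variable
   x_{k+1} is 'X_k with k : 'I_n, so the variables that may occur in an element
   of R_i are the 'X_k with n - i <= k.  In particular R_0 = K and
   R_n = K[x_1, ..., x_n]. *)
Definition tail_poly (K : comNzRingType) (n i : nat) (p : {mpoly K[n]}) : Prop :=
  forall mon : 'X_{1..n}, mon \in msupp p ->
  forall k : 'I_n, (k < n - i)%N -> mon k = 0%N.

(* The homogeneous component of degree s - d of K[x_1, ..., x_n]; it is zero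
   when s < d, the difference s - d being an integer. *)
Definition homog_diff (K : comNzRingType) (n s d : nat) (p : {mpoly K[n]}) : bool :=
  if (d <= s)%N then p \is (s - d)%N.-homog else p == 0.

(* M is the internal direct sum of the additive subgroups Mg s, s in nat, and
   the action respects the grading of K[x_1, ..., x_n] by total degree. *)
Record module_grading (K : comNzRingType) (n : nat)
    (M : lmodType {mpoly K[n]}) (Mg : nat -> M -> Prop) : Prop := ModuleGrading {
  grading0 : forall s, Mg s 0;
  gradingB : forall s x y, Mg s x -> Mg s y -> Mg s (x - y);
  gradingZ : forall t s (p : {mpoly K[n]}) x,
    p \is t.-homog -> Mg s x -> Mg (t + s)%N (p *: x);
  grading_sum : forall x, exists (N : nat) (u : nat -> M),
    (forall s, Mg s (u s)) /\ x = \sum_(s < N) u s;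
  grading_direct : forall (N : nat) (u : nat -> M),
    (forall s, Mg s (u s)) -> \sum_(s < N) u s = 0 ->
    forall s : 'I_N, u s = 0
}.

Definition fin_generated (A : nzRingType) (M : lmodType A) : Prop :=
  exists (k : nat) (a : 'I_k -> M), forall x : M,
  exists c : 'I_k -> A, x = \sum_(j < k) c j *: a j.

(* A finite family (g_{ij}), 0 <= i <= n, is given by the number m i of its
   members with first index i and by the members g i j, j : 'I_(m i). *)

Definition homogeneous_family (V : Type) (Mg : nat -> V -> Prop) (n : nat)
    (m : 'I_n.+1 -> nat) (d : forall i, 'I_(m i) -> nat)
    (g : forall i, 'I_(m i) -> V) : Prop :=
  forall i j, Mg (d i j) (g i j).

Definition max_degree (n : nat) (m : 'I_n.+1 -> nat)
    (d : forall i, 'I_(m i) -> nat) : nat :=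
  \max_(i < n.+1) \max_(j < m i) d i j.

Definition lin_comb (K : comNzRingType) (n : nat) (M : lmodType {mpoly K[n]})
    (m : 'I_n.+1 -> nat) (c : forall i, 'I_(m i) -> {mpoly K[n]})
    (g : forall i, 'I_(m i) -> M) : M :=
  \sum_(i < n.+1) \sum_(j < m i) c i j *: g i j.

Definition generates (K : comNzRingType) (n : nat) (M : lmodType {mpoly K[n]})
    (m : 'I_n.+1 -> nat) (g : forall i, 'I_(m i) -> M) : Prop :=
  forall x : M, exists c : forall i, 'I_(m i) -> {mpoly K[n]},
    (forall (i : 'I_n.+1) (j : 'I_(m i)), tail_poly i (c i j)) /\ x = lin_comb c g.

(* M_s = sum_{i,j} (R_i)_{s - d_{ij}} g_{ij}. *)
Definition generates_deg (K : comNzRingType) (n : nat)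
    (M : lmodType {mpoly K[n]}) (Mg : nat -> M -> Prop)
    (m : 'I_n.+1 -> nat) (d : forall i, 'I_(m i) -> nat)
    (g : forall i, 'I_(m i) -> M) (s : nat) : Prop :=
  forall x : M, Mg s x <->
    exists c : forall i, 'I_(m i) -> {mpoly K[n]},
      (forall (i : 'I_n.+1) (j : 'I_(m i)),
         tail_poly i (c i j) /\ homog_diff s (d i j) (c i j))
      /\ x = lin_comb c g.

Definition is_basis (K : comNzRingType) (n : nat) (M : lmodType {mpoly K[n]})
    (m : 'I_n.+1 -> nat) (g : forall i, 'I_(m i) -> M) : Prop :=
  generates g /\
  forall c : forall i, 'I_(m i) -> {mpoly K[n]},
    (forall (i : 'I_n.+1) (j : 'I_(m i)), tail_poly i (c i j)) -> lin_comb c g = 0 ->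
    forall i j, c i j = 0.

(* The correspondence a_{ij} <-> b_{ij} preserves the multiplication ring R_i
   because it maps the members of a of first index i to those of b of first
   index i. *)
Definition majorizes (K : comNzRingType) (n : nat) (M : lmodType {mpoly K[n]})
    (Mg : nat -> M -> Prop)
    (ma : 'I_n.+1 -> nat) (da : forall i, 'I_(ma i) -> nat)
    (a : forall i, 'I_(ma i) -> M)
    (mb : 'I_n.+1 -> nat) (db : forall i, 'I_(mb i) -> nat)
    (b : forall i, 'I_(mb i) -> M) (D : nat) : Prop :=
  [/\ homogeneous_family Mg da a /\ is_basis a,
      homogeneous_family Mg db b,
      exists f : forall i, 'I_(ma i) -> 'I_(mb i),
        (forall i, bijective (f i)) /\ (forall i j, db i (f i j) = da i j)
    & forall s, (s <= D)%N -> generates_deg Mg db b s].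

(* Main.v *)
Require Import Defs.
From mathcomp Require Import all_boot all_order all_algebra.

Set Implicit Arguments.
Unset Strict Implicit.
Unset Printing Implicit Defensive.

Import GRing.Theory.
Local Open Scope ring_scope.

(** Generation.  Let D = d(M), and let u stand for a pair (i, j).  It is
    enough to show that the R_i-span of s contains M_t for all t, by induction
    on t.  If t > D, then M_(t+1) is
    spanned by the products x_k y with y in M_t, since M is generated by
    elements of degree at most D; by induction y may be taken of the form
    X^a s_u with X^a in the ring R_i attached to s_u.  The difficulty is that
    x_k need not be in R_i.  Now X^a is not 1, because t > D.  Move a variable
    x_l of X^a to the front and rewrite the rest, x_k (X^a / x_l) s_u, which
    lies in M_t, in terms of the multiples X^c s_v of degree t.  The new
    products x_l X^c s_v are either in the span, because x_l is in the ring of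
    s_v, or such that all variables of X^c come after x_l in the order
    x_1, ..., x_n; so the rewriting stops ([tail_span_mulX]).  This parallels
    the proof that local involutivity implies involutivity for Pommaret bases.

    Freeness.  M_t is spanned over K by the finitely many X^a g_u of degree t,
    and freely if g is a basis.  By the first part it is also spanned by the
    X^a s_u, which have the same index set.  Over a commutative ring, a
    spanning family of a free module with as many members as a basis is a
    basis, because A B = 1 implies B A = 1 for square matrices
    ([K_free_transfer]).  A relation among the s_u over the R_i splits into its
    homogeneous components, which are relations over K among the X^a s_u,
    hence trivial ([tail_free_transfer]). *)

(** * Spans and freeness over K inside M *)

Section ScalarSpans.

Variables (K : comNzRingType) (n : nat) (M : lmodType {mpoly K[n]}).
Implicit Types (P : M -> Prop).

(** Every membership in a span below is proved by checking generators: a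
    submodule over K containing them contains the span ([K_span_sub]).  The
    scalars of M being polynomials, k in K acts as k%:MP. *)
Definition K_closed P : Prop :=
  P 0 /\ forall (k : K) (x y : M), P x -> P y -> P (k%:MP *: x + y).

Definition K_span (T : finType) (h : T -> M) x : Prop :=
  exists e : T -> K, x = \sum_z (e z)%:MP *: h z.

Definition K_free (T : finType) (h : T -> M) : Prop :=
  forall e : T -> K, \sum_z (e z)%:MP *: h z = 0 -> forall z, e z = 0.

Lemma K_closedZ P k x : K_closed P -> P x -> P (k%:MP *: x).
Proof. by case=> P0 PD Px; rewrite -[_ *: x]addr0; apply: PD. Qed.

Lemma K_closed_sum P (T : finType) (F : T -> M) :
  K_closed P -> (forall z, P (F z)) -> P (\sum_z F z).
Proof.
case=> P0 PD PF; apply: big_ind => // x y Px Py.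
by rewrite -[x]scale1r -[1]mpolyC1; apply: PD.
Qed.

Lemma K_span_sub P (T : finType) (h : T -> M) x :
  K_closed P -> (forall z, P (h z)) -> K_span h x -> P x.
Proof.
by move=> cP Ph [e ->]; apply: K_closed_sum => // z; apply: K_closedZ.
Qed.

Lemma K_span_closed (T : finType) (h : T -> M) : K_closed (K_span h).
Proof.
split; first by exists (fun=> 0); rewrite big1 // => z _; rewrite scale0r.
move=> k _ _ [e ->] [f ->]; exists (fun z => k * e z + f z).
rewrite scaler_sumr -big_split; apply: eq_bigr => z _ /=.
by rewrite mpolyCD mpolyCM scalerDl scalerA.
Qed.

Lemma K_span_mem (T : finType) (h : T -> M) z : K_span h (h z).
Proof.
exists (fun w => (w == z)%:R); rewrite (bigD1 z) //= eqxx mpolyC1 scale1r.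
by rewrite big1 ?addr0 // => w /negbTE->; rewrite mpolyC0 scale0r.
Qed.

Lemma K_closed_scale P (p : {mpoly K[n]}) :
  K_closed P -> K_closed (fun y => P (p *: y)).
Proof.
case=> P0 PD; split=> [|k x y Px Py]; first by rewrite scaler0.
by rewrite scalerDr scalerA mulrC -scalerA; apply: PD.
Qed.

Lemma fin_mulmx1C (T : finType) (A B : T -> T -> K) :
  (forall x y, \sum_z A x z * B z y = (x == y)%:R) ->
  forall x y, \sum_z B x z * A z y = (x == y)%:R.
Proof.
pose mx (C : T -> T -> K) : 'M[K]_#|T| :=
  \matrix_(i, j) C (enum_val i) (enum_val j).
have mxM C D i j :
    (mx C *m mx D) i j = \sum_z C (enum_val i) z * D z (enum_val j).
  rewrite mxE [RHS](reindex_onto enum_val enum_rank) /=; last first.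
    by move=> z _; rewrite enum_rankK.
  by apply: eq_big => [k|k _]; rewrite ?enum_valK ?eqxx // !mxE.
move=> AB x y; have /mulmx1C/matrixP BA : mx A *m mx B = 1%:M.
  by apply/matrixP => i j; rewrite mxM AB mxE (inj_eq enum_val_inj).
have := BA (enum_rank x) (enum_rank y).
by rewrite mxM mxE !enum_rankK (inj_eq enum_rank_inj).
Qed.

(** A surjective endomorphism of a free module of finite rank is injective.  If
    h' = A h and h = B h', freeness of h gives B A = 1, hence A B = 1, and a
    relation c h' = c A h = 0 forces c A = 0, so that c = c A B = 0. *)
Lemma K_free_transfer (T : finType) (h h' : T -> M) :
  K_free h -> (forall z, K_span h (h' z)) -> (forall z, K_span h' (h z)) ->
  K_free h'.
Proof.
move=> free_h /fin_all_exists[A defh'] /fin_all_exists[B defh].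
have compose (e : T -> K) (C : T -> T -> K) (h1 h2 : T -> M) :
    (forall z, h1 z = \sum_w (C z w)%:MP *: h2 w) ->
  \sum_z (e z)%:MP *: h1 z = \sum_w (\sum_z e z * C z w)%:MP *: h2 w.
  move=> h12; under eq_bigr do rewrite h12 scaler_sumr.
  rewrite exchange_big; apply: eq_bigr => w _ /=.
  rewrite raddf_sum scaler_suml; apply: eq_bigr => z _ /=.
  by rewrite scalerA mpolyCM.
have BA (x y : T) : \sum_z B x z * A z y = (x == y)%:R.
  apply/eqP; rewrite -subr_eq0; apply/eqP.
  apply: (free_h (fun y => \sum_z B x z * A z y - (x == y)%:R)).
  under eq_bigr do rewrite mpolyCB scalerBl.
  rewrite sumrB -(compose _ _ _ _ defh') -defh (bigD1 x) //= eqxx.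
  rewrite mpolyC1 scale1r big1 ?addr0 ?subrr // => z.
  by rewrite eq_sym => /negbTE->; rewrite mpolyC0 scale0r.
move=> e; rewrite (compose _ _ _ _ defh') => /free_h eA z.
have AB := fin_mulmx1C BA.
transitivity (\sum_w (\sum_v e v * A v w) * B w z).
  under eq_bigr do rewrite mulr_suml.
  rewrite exchange_big (bigD1 z) //= [X in _ + X]big1 => [|v /negbTE vz].
    by under eq_bigr do rewrite -mulrA; rewrite -mulr_sumr AB eqxx mulr1 addr0.
  by under eq_bigr do rewrite -mulrA; rewrite -mulr_sumr AB vz mulr0.
by rewrite big1 // => w _; rewrite eA mul0r.
Qed.

End ScalarSpans.

(** * Monomials and homogeneous components of the rings R_i *)

Definition tail_mon (n i : nat) (a : 'X_{1..n}) : bool :=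
  [forall k : 'I_n, (k < n - i)%N ==> (a k == 0%N)].

Lemma tail_monP n i (a : 'X_{1..n}) :
  reflect (forall k : 'I_n, (k < n - i)%N -> a k = 0%N) (tail_mon i a).
Proof.
by apply: (iffP forallP) => H k; [move/(implyP (H k))/eqP|apply/implyP=> /H->].
Qed.

Lemma tail_monD n i (a b : 'X_{1..n}) :
  tail_mon i (a + b)%MM = tail_mon i a && tail_mon i b.
Proof.
apply/tail_monP/andP => [H|[/tail_monP Ha /tail_monP Hb] k lt_k]; last first.
  by rewrite mnmDE Ha ?Hb.
by split; apply/tail_monP => k /H; rewrite mnmDE => /eqP;
  rewrite addn_eq0 => /andP[/eqP ? /eqP ?].
Qed.

Lemma tail_mon1 n i (k : 'I_n) : tail_mon i U_(k)%MM = (n - i <= k)%N.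
Proof.
rewrite leqNgt; apply/tail_monP/idP => [H|/negP H l lt_l].
  by apply/negP=> /H; rewrite mnm1E eqxx.
by rewrite mnm1E; case: eqP lt_l => // <-.
Qed.

Lemma mon_has_var n (a : 'X_{1..n}) e :
  (e < mdeg a + e)%N -> exists k : 'I_n, a k != 0%N.
Proof.
move=> lt_e; apply/existsP; apply: contraTT lt_e => /existsPn a0.
rewrite -leqNgt mdegE big1 // => k _.
by apply/eqP; have := a0 k; rewrite negbK.
Qed.

Section Polynomials.

Variables (K : comNzRingType) (n : nat).
Implicit Types (p : {mpoly K[n]}) (a : 'X_{1..n}).

Lemma tail_polyP i p :
  tail_poly i p <-> (forall a, p@_a != 0 -> tail_mon i a).
Proof.
split=> H a.
  by rewrite -mcoeff_msupp => /H Ha; apply/tail_monP.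
by rewrite mcoeff_msupp => /H/tail_monP.
Qed.

Lemma tail_poly0 i : tail_poly i (0 : {mpoly K[n]}).
Proof. by apply/tail_polyP => a; rewrite mcoeff0 eqxx. Qed.

Lemma tail_polyD i p p' :
  tail_poly i p -> tail_poly i p' -> tail_poly i (p + p').
Proof.
move=> /tail_polyP Hp /tail_polyP Hq; apply/tail_polyP => a; rewrite mcoeffD.
by have [-> | /Hp->//] := eqVneq p@_a 0; rewrite add0r => /Hq.
Qed.

Lemma tail_polyZ i k p : tail_poly i p -> tail_poly i (k *: p).
Proof.
move=> /tail_polyP Hp; apply/tail_polyP => a; rewrite mcoeffZ.
by have [-> | /Hp->//] := eqVneq p@_a 0; rewrite mulr0 eqxx.
Qed.

Lemma tail_polyX i a : tail_mon i a -> tail_poly i ('X_[a] : {mpoly K[n]}).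
Proof.
move=> Ha; apply/tail_polyP => b; rewrite mcoeffX.
by have [<- | _] := eqVneq a b; rewrite ?eqxx.
Qed.

Lemma tail_poly_sum i (T : Type) (s : seq T) (Q : pred T) F :
  (forall z, Q z -> tail_poly i (F z)) ->
  tail_poly i (\sum_(z <- s | Q z) F z : {mpoly K[n]}).
Proof.
by apply: big_ind => [|p q]; [apply: tail_poly0 | apply: tail_polyD].
Qed.

Lemma mcoeff_pihomog q p a :
  (pihomog mdeg q p)@_a = if mdeg a == q then p@_a else 0.
Proof.
rewrite pihomogE raddf_sum /=.
under eq_bigr do rewrite mcoeffZ mcoeffX.
case: ifP => [dq | ndq].
  have [ap | /memN_msupp_eq0 ap] := boolP (a \in msupp p).
    rewrite big_mkcond (bigD1_seq a) ?msupp_uniq //= dq eqxx mulr1 big1 ?addr0 //.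
    by move=> b /negbTE->; rewrite mulr0 if_same.
  rewrite ap big1 // => b _.
  by have [-> | _] := eqVneq b a; rewrite ?ap ?mul0r ?mulr0.
by rewrite big1 // => b; have [-> | _] := eqVneq b a; rewrite ?mulr0 // ndq.
Qed.

(** The component of p that contributes to degree t of M when p multiplies an
    element of degree e. *)
Definition hcomp (t e : nat) p : {mpoly K[n]} :=
  if (e <= t)%N then pihomog mdeg (t - e)%N p else 0.

Lemma mcoeff_hcomp t e p a :
  (hcomp t e p)@_a = if (mdeg a + e == t)%N then p@_a else 0.
Proof.
rewrite /hcomp; case: leqP => [le_et | lt_te].
  by rewrite mcoeff_pihomog -(eqn_add2r e) subnK.
by rewrite mcoeff0; case: eqP lt_te => // <-; rewrite ltnNge leq_addl.
Qed.

Lemma hcomp_homog t e p : homog_diff t e (hcomp t e p).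
Proof. by rewrite /homog_diff /hcomp; case: leqP => // _; apply: pihomogP. Qed.

Lemma hcomp_tail t e i p : tail_poly i p -> tail_poly i (hcomp t e p).
Proof.
move/tail_polyP=> Hp; apply/tail_polyP => a; rewrite mcoeff_hcomp.
by case: ifP; [move=> _ /Hp | rewrite eqxx].
Qed.

Lemma homog_diff_coeff t e p a :
  homog_diff t e p -> p@_a != 0 -> (mdeg a + e = t)%N.
Proof.
rewrite /homog_diff; case: leqP => [le_et hp | _ /eqP->]; last first.
  by rewrite mcoeff0 eqxx.
have [-> | ne] := eqVneq (mdeg a) (t - e)%N; first by rewrite subnK.
by rewrite (dhomog_nemf_coeff hp ne) eqxx.
Qed.

End Polynomials.

(** * Generation and freeness over the rings R_i, degree by degree *)

Section FlatFamilies.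

Variables (K : comNzRingType) (n : nat) (M : lmodType {mpoly K[n]}).
Variables (Mg : nat -> M -> Prop) (hMg : module_grading Mg).
Variables (I : finType) (r d : I -> nat).
Implicit Types (s g : I -> M) (c : I -> {mpoly K[n]}) (t : nat).

Definition tails c : Prop := forall u, tail_poly (r u) (c u).

Definition tail_span s (x : M) : Prop :=
  exists c, tails c /\ x = \sum_u c u *: s u.

Definition tail_free s : Prop :=
  forall c, tails c -> \sum_u c u *: s u = 0 -> forall u, c u = 0.

(** The monomial multiples X^a s_u of degree t with a in the ring attached to
    u: a finite set that depends on the degrees and the rings only, hence is
    shared by g and s.  The bound t.+1 on a makes the type finite and excludes
    nothing, since mdeg a <= t. *)
Definition mon_index t : {set I * 'X_{1..n < t.+1}} :=
  [set z : I * 'X_{1..n < t.+1} |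
     tail_mon (r z.1) z.2 & (mdeg z.2 + d z.1 == t)%N].

Definition mon_mul t s (z : {z in mon_index t}) : M :=
  'X_[(val z).2] *: s (val z).1.

Lemma mon_indexP t (z : {z in mon_index t}) :
  tail_mon (r (val z).1) (val z).2 /\ (mdeg (val z).2 + d (val z).1 = t)%N.
Proof. by case: z => z /=; rewrite inE => /andP[-> /eqP]. Qed.

Lemma mon_index_ex t (u : I) (a : 'X_{1..n}) :
  tail_mon (r u) a -> (mdeg a + d u = t)%N ->
  exists z : {z in mon_index t}, (val z).1 = u /\ (val z).2 = a :> 'X_{1..n}.
Proof.
move=> Ha Hd; have lt_a : (mdeg a < t.+1)%N by rewrite ltnS -Hd leq_addr.
have Hz : (u, BMultinom lt_a) \in mon_index t by rewrite inE /= Ha Hd eqxx.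
by exists (exist (fun z => z \in mon_index t) _ Hz).
Qed.

Lemma K_span_mon t s (u : I) (a : 'X_{1..n}) :
  tail_mon (r u) a -> (mdeg a + d u = t)%N ->
  K_span (@mon_mul t s) ('X_[a] *: s u).
Proof.
move=> Ha Hd; have [z [<- <-]] := mon_index_ex Ha Hd.
exact: (K_span_mem (@mon_mul t s)).
Qed.

Lemma tail_span_closed s : K_closed (tail_span s).
Proof.
split; first exists (fun=> 0).
  by split=> [u|]; [apply: tail_poly0 | rewrite big1 // => u _; rewrite scale0r].
move=> k _ _ [c [Hc ->]] [c' [Hc' ->]]; exists (fun u => k *: c u + c' u).
split=> [u|]; first by apply: tail_polyD => //; apply: tail_polyZ.
rewrite scaler_sumr -big_split; apply: eq_bigr => u _ /=.
by rewrite scalerDl scalerA mul_mpolyC.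
Qed.

Lemma tail_span_mem s (u : I) p : tail_poly (r u) p -> tail_span s (p *: s u).
Proof.
move=> Hp; exists (fun v => if v == u then p else 0); split=> [v|].
  by case: eqP => [->|_] //; apply: tail_poly0.
rewrite (bigD1 u) //= eqxx big1 ?addr0 // => v /negbTE->.
by rewrite scale0r.
Qed.

Lemma mon_expansion t s c :
  tails c -> (forall u, homog_diff t (d u) (c u)) ->
  \sum_u c u *: s u =
  \sum_(z : {z in mon_index t}) ((c (val z).1)@_(val z).2)%:MP *: mon_mul s z.
Proof.
move=> Hc Hd; have msz u : (msize (c u) <= t.+1)%N.
  rewrite msizeE; apply/bigmax_leqP_seq => a; rewrite mcoeff_msupp => ca _.
  by rewrite ltnS -(homog_diff_coeff (Hd u) ca) leq_addr.
transitivity (\sum_(z : I * 'X_{1..n < t.+1})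
                ((c z.1)@_z.2)%:MP *: ('X_[z.2] *: s z.1)).
  rewrite -(pair_bigA _ (fun u (a : 'X_{1..n < t.+1}) =>
    ((c u)@_a)%:MP *: ('X_[a] *: s u))) /=.
  apply: eq_bigr => u _; rewrite {1}(mpolywE (msz u)) scaler_suml.
  by apply: eq_bigr => a _; rewrite scalerA mul_mpolyC.
rewrite -(big_sub (mon_index t)
  (fun z => ((c z.1)@_z.2)%:MP *: ('X_[z.2] *: s z.1))).
rewrite [RHS]big_mkcond /=; apply: eq_bigr => -[u a] _ /=.
case: ifPn => //; rewrite inE /=; have [-> _ | ca] := eqVneq ((c u)@_a) 0.
  by rewrite mpolyC0 scale0r.
rewrite (homog_diff_coeff (Hd u) ca) eqxx andbT.
by have /tail_polyP->// := Hc u.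
Qed.

Lemma K_span_comb t s c :
  tails c -> (forall u, homog_diff t (d u) (c u)) ->
  K_span (@mon_mul t s) (\sum_u c u *: s u).
Proof.
move=> Hc Hd; rewrite (mon_expansion s Hc Hd).
by exists (fun z : {z in mon_index t} => (c (val z).1)@_(val z).2).
Qed.

Lemma Mg_sum (J : finType) (Q : pred J) t (F : J -> M) :
  (forall j, Q j -> Mg t (F j)) -> Mg t (\sum_(j | Q j) F j).
Proof.
apply: big_ind => [|x y Hx Hy]; first exact: (grading0 hMg).
by rewrite -[y]opprK -[- y]sub0r; do 2!apply: (gradingB hMg) => //;
  apply: (grading0 hMg).
Qed.

(** The family (the degree q part of the sum, minus x when q = t) sums to zero,
    so the directness of the grading kills each of its members. *)
Lemma degree_part (J : finType) (e : J -> nat) (F : J -> M) t x :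
  (forall j, Mg (e j) (F j)) -> Mg t x -> x = \sum_j F j ->
  x = \sum_(j | e j == t) F j.
Proof.
move=> HF Hx Dx; pose N := (\max_j e j + t).+1.
have lt_e j : (e j < N)%N by rewrite ltnS (leq_trans (leq_bigmax j)) ?leq_addr.
have lt_t : (t < N)%N by rewrite ltnS leq_addl.
pose w q := \sum_(j | e j == q) F j - (if q == t then x else 0).
have Hw q : Mg q (w q).
  apply: (gradingB hMg); first by apply: Mg_sum => j /eqP <-.
  by case: eqP => [->|_] //; apply: (grading0 hMg).
have w0 : \sum_(q < N) w q = 0.
  rewrite sumrB -big_mkcond /= [X in _ - X](big_pred1 (Ordinal lt_t)) // Dx.
  rewrite [X in _ - X](partition_big (fun j => Ordinal (lt_e j)) xpredT) //=.
  by rewrite subrr.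
have /eqP := grading_direct hMg Hw w0 (Ordinal lt_t).
by rewrite /w /= eqxx subr_eq0 => /eqP.
Qed.

Lemma degree_comb t s c x :
  (forall u, Mg (d u) (s u)) -> Mg t x -> x = \sum_u c u *: s u ->
  x = \sum_u hcomp t (d u) (c u) *: s u.
Proof.
move=> Hs Hx Dx; pose N := (\max_u msize (c u) + t).+1.
have lt_c u : (msize (c u) <= N)%N.
  apply/ltnW; rewrite ltnS; apply: leq_trans (leq_addr _ _).
  exact: (leq_bigmax (F := fun v => msize (c v))).
have {1}-> := @degree_part (I * 'I_N)%type (fun j => j.2 + d j.1)%N
  (fun j => pihomog mdeg j.2 (c j.1) *: s j.1) t x _ Hx _.
- rewrite big_mkcond -(pair_bigA _ (fun u (q : 'I_N) => if (q + d u == t)%N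
     then pihomog mdeg q (c u) *: s u else 0)) /=.
  apply: eq_bigr => u _; rewrite -big_mkcond /= /hcomp.
  case: leqP => [le_dt | lt_td].
    have lt_tN : (t - d u < N)%N.
      by rewrite ltnS (leq_trans (leq_subr _ _)) ?leq_addl.
    rewrite (big_pred1 (Ordinal lt_tN)) // => q /=.
    by rewrite -val_eqE /= -[RHS](eqn_add2r (d u)) subnK.
  rewrite big_pred0 ?scale0r // => q.
  by case: eqP lt_td => // <-; rewrite ltnNge leq_addl.
- by move=> [u q] /=; apply: (gradingZ hMg) => //; apply: pihomogP.
rewrite Dx -(pair_bigA _ (fun u (q : 'I_N) => pihomog mdeg q (c u) *: s u)) /=.
apply: eq_bigr => u _.
by rewrite -scaler_suml -pihomog_partitionE.
Qed.

Lemma degree_span t s x :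
  (forall u, Mg (d u) (s u)) -> Mg t x -> tail_span s x ->
  K_span (@mon_mul t s) x.
Proof.
move=> Hs Hx [c [Hc /(degree_comb Hs Hx)->]].
by apply: K_span_comb => u; [apply: hcomp_tail | apply: hcomp_homog].
Qed.

Lemma Mg_mon t s (z : {z in mon_index t}) :
  (forall u, Mg (d u) (s u)) -> Mg t (mon_mul s z).
Proof.
move=> Hs; have [_ Dz] := mon_indexP z.
by rewrite -[in Mg t]Dz; apply: (gradingZ hMg); rewrite ?dhomogX.
Qed.

(** The reordering step.  Suppose 'X_k is not in the ring of u.  Take a
    variable 'X_l that divides X^a, and write X^a = 'X_l X^b.  Then
    'X_k X^b s_u again has degree t, hence is a K-combination of multiples
    X^c s_v with c in the ring of v, and it remains to multiply these by 'X_l.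
    If 'X_l is in the ring of v, that product is in the span.  Otherwise all
    variables of X^c have an index larger than l, and induction on this index
    applies.  The assumption D < t ensures that X^a and all the X^c that occur
    are divisible by some variable. *)
Lemma tail_span_mulX t s (u : I) (k : 'I_n) (a : 'X_{1..n}) D :
  (D < t)%N -> (forall v, d v <= D)%N ->
  (forall x, Mg t x -> K_span (@mon_mul t s) x) ->
  (forall u, Mg (d u) (s u)) ->
  tail_mon (r u) a -> (mdeg a + d u = t)%N ->
  tail_span s ('X_k *: ('X_[a] *: s u)).
Proof.
move=> lt_Dt le_dD gen_t Hs.
have X_ok v (l : 'I_n) (b : 'X_{1..n}) : tail_mon (r v) b -> (n - r v <= l)%N ->
    tail_span s ('X_l *: ('X_[b] *: s v)).
  move=> Hb Hl; rewrite scalerA -mpolyXD; apply: tail_span_mem.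
  by apply: tail_polyX; rewrite tail_monD tail_mon1 Hl.
have var_ex v (b : 'X_{1..n}) : (mdeg b + d v = t)%N -> exists l, b l != 0%N.
  move=> Db; apply: (@mon_has_var _ _ (d v)).
  by rewrite Db (leq_ltn_trans _ lt_Dt).
move=> Ha Da; have [l al] := var_ex u a Da.
(* The variable l of a matters only through n - l, which decreases. *)
have [e le_e] := ubnP (n - l)%N.
elim: e => // e IHe in u a k l Ha Da al le_e *.
have [/X_ok|lt_kr] := leqP (n - r u)%N k; first exact.
have le_U : (U_(l) <= a)%MM by rewrite lep1mP.
have Dla : (a - U_(l) + U_(l))%MM = a by rewrite submK.
move: Ha Da; rewrite -Dla tail_monD mdegD mdeg1 => /andP[Ha' _] Da'.
rewrite mpolyXD mulrC -scalerA scalerA mulrC -scalerA.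
apply: (@K_span_sub _ _ _ (fun y => tail_span s ('X_l *: y)) _ (@mon_mul t s)).
- exact/K_closed_scale/tail_span_closed.
- move=> z; have [Hz Dz] := mon_indexP z.
  have [/X_ok|lt_lr] := leqP (n - r (val z).1)%N l; first exact.
  have [j zj] := var_ex _ _ Dz; apply: (IHe _ _ _ j) => //.
  have le_rj : (n - r (val z).1 <= j)%N.
    by rewrite leqNgt; apply: contra zj => /(tail_monP _ _ Hz)->.
  rewrite -ltnS (leq_trans _ le_e) // ltnS ltn_sub2l //.
  exact: leq_trans lt_lr le_rj.
apply: gen_t; have -> : t = (1 + (mdeg (a - U_(l)) + d u))%N.
  by rewrite -Da' addnAC addnC.
apply: (gradingZ hMg); first by rewrite dhomogX /= mdeg1.
by apply: (gradingZ hMg); rewrite ?dhomogX.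
Qed.

(** As the degrees of g are at most D < t, every element of degree t.+1 is a
    combination of products of a variable with an element of degree t, and
    these products are handled by [tail_span_mulX]. *)
Lemma degree_span_step g s (D t : nat) :
  (forall u, d u <= D)%N -> (D < t)%N ->
  (forall u, Mg (d u) (g u)) -> (forall u, Mg (d u) (s u)) ->
  (forall x, tail_span g x) ->
  (forall x, Mg t x -> K_span (@mon_mul t s) x) ->
  forall x, Mg t.+1 x -> K_span (@mon_mul t.+1 s) x.
Proof.
move=> le_dD lt_Dt Hg Hs gen_g gen_t x Hx; apply: degree_span => //.
apply: (K_span_sub (tail_span_closed s) _ (degree_span Hg Hx (gen_g x))).
move=> z; have [Hz Dz] := mon_indexP z; rewrite /mon_mul.
move: (val z).1 (val z).2 Hz Dz => u [a /= _] Ha Da.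
have [k ak] : exists k, a k != 0%N.
  apply: (@mon_has_var _ _ (d u)).
  by rewrite Da ltnW // ltnS (leq_ltn_trans _ lt_Dt).
have Dka : (U_(k) + (a - U_(k)))%MM = a by rewrite addmC submK // lep1mP.
rewrite -Dka mpolyXD -scalerA.
have := K_closed_scale 'X_k (tail_span_closed s) => closed_k.
apply: (K_span_sub closed_k _ (gen_t _ _)) => [w|].
  have [Hw Dw] := mon_indexP w.
  exact: (tail_span_mulX _ lt_Dt le_dD gen_t Hs Hw Dw).
have -> : t = (mdeg (a - U_(k)) + d u)%N.
  by apply: succn_inj; rewrite -Da -[in LHS]Dka mdegD mdeg1.
by apply: (gradingZ hMg); rewrite ?dhomogX.
Qed.

Lemma tail_span_of_low_degrees g s (D : nat) :
  (forall u, d u <= D)%N ->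
  (forall u, Mg (d u) (g u)) -> (forall u, Mg (d u) (s u)) ->
  (forall x, tail_span g x) ->
  (forall t, (t <= D.+1)%N -> forall x, Mg t x -> K_span (@mon_mul t s) x) ->
  forall x, tail_span s x.
Proof.
move=> le_dD Hg Hs gen_g gen_low x.
have gen_deg t y : Mg t y -> K_span (@mon_mul t s) y.
  have [/gen_low|] := leqP t D.+1; first exact.
  elim: t y => // t IHt y lt_Dt; apply: (degree_span_step le_dD _ Hg Hs gen_g).
    by rewrite -ltnS.
  move: lt_Dt; rewrite ltnS leq_eqVlt => /predU1P[<- | lt_Dt] z; last exact: IHt.
  exact: gen_low.
have [N [w [Hw ->]]] := grading_sum hMg x.
apply: (K_closed_sum (tail_span_closed s)) => q.
apply: (K_span_sub (tail_span_closed s) _ (gen_deg _ _ (Hw q))) => z.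
by have [Hz _] := mon_indexP z; apply/tail_span_mem/tail_polyX.
Qed.

(** A relation among the multiples X^a g_u is a relation among the g_u whose
    coefficient at u collects the terms with first component u. *)
Lemma mon_free t g : tail_free g -> K_free (@mon_mul t g).
Proof.
move=> free_g e e0 z.
pose c u : {mpoly K[n]} :=
  \sum_(w : {w in mon_index t} | (val w).1 == u) (e w)%:MP * 'X_[(val w).2].
have Hc : tails c.
  move=> u; apply: tail_poly_sum => w /eqP <-; rewrite mul_mpolyC.
  by apply/tail_polyZ/tail_polyX; have [] := mon_indexP w.
have c0 : \sum_u c u *: g u = 0.
  rewrite -[RHS]e0 [RHS](partition_big (fun w => (val w).1) xpredT) //=.
  apply: eq_bigr => u _; rewrite scaler_suml.
  by apply: eq_bigr => w /eqP <-; rewrite -scalerA.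
have := congr1 (mcoeff (val z).2) (free_g c Hc c0 (val z).1).
rewrite mcoeff0 raddf_sum (bigD1 z) //= mcoeffCM mcoeffX eqxx mulr1.
rewrite big1 ?addr0 // => w /andP[/eqP zw1 ne_wz].
rewrite mcoeffCM mcoeffX; case: eqP => [zw2 | _]; last by rewrite mulr0.
case/eqP: ne_wz; apply: val_inj.
by apply/eqP; rewrite -pair_eqE /pair_eq zw1 -val_eqE /= zw2 !eqxx.
Qed.

(** In each degree the monomial multiples of g and those of s are two families
    over one finite index set that span each other over K. *)
Lemma tail_free_transfer g s :
  (forall u, Mg (d u) (g u)) -> (forall u, Mg (d u) (s u)) ->
  (forall x, tail_span g x) -> (forall x, tail_span s x) ->
  tail_free g -> tail_free s.
Proof.
move=> Hg Hs gen_g gen_s free_g c Hc c0 u; apply/mpolyP => a.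
rewrite mcoeff0; apply/eqP/negPn/negP => ca.
have Ha : tail_mon (r u) a by have /tail_polyP->// := Hc u.
pose t := (mdeg a + d u)%N.
have free_s : K_free (@mon_mul t s).
  apply: (K_free_transfer (mon_free free_g)) => z.
    by apply: degree_span => //; apply: Mg_mon.
  by apply: degree_span => //; apply: Mg_mon.
have := degree_comb Hs (grading0 hMg t) (esym c0).
rewrite (@mon_expansion t) => [/esym/free_s e0||]; first 1 last.
- by move=> v; apply: hcomp_tail.
- by move=> v; apply: hcomp_homog.
have [z [Dz1 Dz2]] := @mon_index_ex t u a Ha (erefl t).
by case/eqP: ca; have := e0 z; rewrite Dz1 Dz2 mcoeff_hcomp eqxx.
Qed.

End FlatFamilies.

(** * Families indexed by pairs (i, j) *)

Section IndexedFamilies.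

Variables (K : comNzRingType) (n : nat) (M : lmodType {mpoly K[n]}).
Implicit Types (m : 'I_n.+1 -> nat) (x : M).

Definition flat (V : Type) m (s : forall i, 'I_(m i) -> V)
  (u : {i : 'I_n.+1 & 'I_(m i)}) : V := s (tag u) (tagged u).

Definition ring_index m (u : {i : 'I_n.+1 & 'I_(m i)}) : nat := tag u.

Lemma lin_combE m c (s : forall i, 'I_(m i) -> M) :
  lin_comb c s = \sum_u flat c u *: flat s u.
Proof. exact: (sig_big_dep xpredT (fun=> xpredT)). Qed.

Lemma lin_comb_flat m (c : {i : 'I_n.+1 & 'I_(m i)} -> {mpoly K[n]})
    (s : forall i, 'I_(m i) -> M) :
  lin_comb (fun i j => c (Tagged (fun i => 'I_(m i)) j)) s =
  \sum_u c u *: flat s u.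
Proof. by rewrite lin_combE; apply: eq_bigr => -[]. Qed.

Lemma generatesE m (s : forall i, 'I_(m i) -> M) :
  generates s <-> forall x, tail_span (@ring_index m) (flat s) x.
Proof.
split=> gen_s x; have [c [Hc ->]] := gen_s x.
  by exists (flat c); rewrite lin_combE; split=> // u; apply: Hc.
exists (fun i j => c (Tagged (fun i => 'I_(m i)) j)); rewrite lin_comb_flat.
by split=> // i j; apply: Hc.
Qed.

Lemma freeE m (s : forall i, 'I_(m i) -> M) :
  (forall c : forall i, 'I_(m i) -> {mpoly K[n]},
     (forall (i : 'I_n.+1) j, tail_poly i (c i j)) -> lin_comb c s = 0 ->
     forall i j, c i j = 0) <->
  tail_free (@ring_index m) (flat s).
Proof.
split=> free_s c Hc c0.
  move=> [i j]; rewrite -lin_comb_flat in c0.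
  by apply: (free_s _ _ c0) => i' j'; apply: Hc.
move=> i j; rewrite lin_combE in c0.
by apply: (free_s _ _ c0 (Tagged _ j)) => u; apply: Hc.
Qed.

Lemma generates_degW Mg m (d : forall i, 'I_(m i) -> nat)
    (s : forall i, 'I_(m i) -> M) t x :
  generates_deg Mg d s t -> Mg t x ->
  K_span (@mon_mul K n M _ (@ring_index m) (flat d) t (flat s)) x.
Proof.
move=> gen_t /gen_t[c [Hc ->]]; rewrite lin_combE.
by apply: K_span_comb => u; have [] := Hc (tag u) (tagged u).
Qed.

Lemma flat_le_max m (d : forall i, 'I_(m i) -> nat) u :
  (flat d u <= max_degree d)%N.
Proof.
case: u => i j; rewrite /flat /max_degree /=.
apply: leq_trans (leq_bigmax (F := fun i => \max_(j < m i) d i j) i).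
exact: leq_bigmax.
Qed.

End IndexedFamilies.

Theorem theorem4p1p12 (K : comNzRingType) (n : nat)
    (M : lmodType {mpoly K[n]}) (Mg : nat -> M -> Prop)
    (hMg : module_grading Mg) (hfg : fin_generated M)
    (m : 'I_n.+1 -> nat) (d : forall i, 'I_(m i) -> nat)
    (g : forall i, 'I_(m i) -> M)
    (hg : homogeneous_family Mg d g) (hgen : generates g) :
  (forall s : forall i, 'I_(m i) -> M,
     homogeneous_family Mg d s ->
     (forall t, (t <= max_degree d + 1)%N -> generates_deg Mg d s t) ->
     generates s)
  /\
  (is_basis g ->
   forall (m' : 'I_n.+1 -> nat) (d' : forall i, 'I_(m' i) -> nat)
     (s : forall i, 'I_(m' i) -> M),
     majorizes Mg d g d' s (max_degree d + 1) ->
     is_basis s).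
Proof.
have flat_g u : Mg (flat d u) (flat g u) by apply: hg.
have gen_g := (generatesE g).1 hgen.
have gen_of_low (s : forall i, 'I_(m i) -> M) : homogeneous_family Mg d s ->
    (forall t, (t <= max_degree d + 1)%N -> forall x, Mg t x ->
       K_span (@mon_mul K n M _ (@ring_index n m) (flat d) t (flat s)) x) ->
    generates s.
  move=> hs low; apply/generatesE.
  apply: (tail_span_of_low_degrees hMg (flat_le_max d) flat_g) => //.
  - by move=> u; apply: hs.
  - by move=> t; rewrite -addn1; apply: low.
split=> [s hs low | [_ /freeE free_g] m' d' s].
  by apply: gen_of_low => // t /low gen_t x; apply: generates_degW.
case=> [_ hs [f [bij_f deg_f]] low].
pose sf i j := s i (f i j).
have hsf : homogeneous_family Mg d sf by move=> i j; rewrite -deg_f; apply: hs.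
have surj_f i j' : exists j, j' = f i j.
  by have [f' _ fK] := bij_f i; exists (f' j').
have gen_sf : generates sf.
  apply: gen_of_low => // t /low gen_t x /(generates_degW gen_t).
  apply: K_span_sub (K_span_closed _) _ => z; have [Hz Dz] := mon_indexP z.
  rewrite /mon_mul; move: (val z).1 (val z).2 Hz Dz => [i j'] a.
  have [j ->] := surj_f i j'; rewrite /flat /= deg_f => Ha Da.
  exact: (@K_span_mon _ _ _ _ _ (flat d) t (flat sf) (Tagged _ j)).
have free_sf : tail_free (@ring_index n m) (flat sf).
  apply: (tail_free_transfer hMg flat_g _ gen_g) => //; last exact/generatesE.
  by move=> u; apply: hsf.
split.
  apply/generatesE => x; have [c [Hc ->]] := (generatesE sf).1 gen_sf x.
  apply: K_closed_sum (tail_span_closed _ _) _ => u.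
  pose fu := Tagged (fun i => 'I_(m' i)) (f (tag u) (tagged u)).
  exact: (tail_span_mem (r := @ring_index n m') (flat s) (u := fu) (Hc u)).
move=> c Hc c0 i j'; have [j ->] := surj_f i j'.
apply: (((freeE sf).2 free_sf) (fun i j => c i (f i j))) => [i1 j1|].
  exact: Hc.
rewrite -[RHS]c0; apply: eq_bigr => i1 _; rewrite [RHS](reindex (f i1)) //.
exact: (onW_bij _ (bij_f i1)).
Qed.
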